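(* Let $d\ge3$ be odd, let $1<p<\infty$ and $\frac{2d+2}{d-1}\le r<\infty$. Suppose that $R^*(p\to r)\lesssim 1$ for the spheres $S_j\subset\mathbb{F}_q^d$ over fields in which $-1$ is a square; that is, suppose there is a constant $C$ such that for every odd prime power $q$ for which $-1$ is a square in $\mathbb{F}_q$, every $j\in\mathbb{F}_q^*$ and every $f:S_j\to\mathbb{C}$, $$\|\widehat{fd\sigma}\|_{L^r(\mathbb{F}_q^d,dm)}\le C\,\|f\|_{L^p(S_j,d\sigma)}.$$ Then $$r\ge\frac{p(d+1)}{(p-1)(d-1)}.$$
   Context: $\mathbb{F}_q$ is the finite field with $q$ elements, where $q$ is a power of an odd prime; $\mathbb{F}_q^*=\mathbb{F}_q\setminus\{0\}$. For $x\in\mathbb{F}_q^d$ put $\|x\|_2=x_1^2+\dots+x_d^2\in\mathbb{F}_q$, and for $j\in\mathbb{F}_q^*$ let $S_j=\{x\in\mathbb{F}_q^d:\|x\|_2=j\}$. Fix for each $q$ a non-trivial additive character $\chi:\mathbb{F}_q\to\mathbb{C}$, and let $x\cdot m$ be the usual dot product. With $d\sigma$ the normalized surface measure on $S=S_j$, for $f:S\to\mathbb{C}$ define $$\widehat{fd\sigma}(m)=\frac1{|S|}\sum_{x\in S}\chi(-x\cdot m)f(x)\quad(m\in\mathbb{F}_q^d),$$ $$\|f\|_{L^p(S,d\sigma)}^p=\frac1{|S|}\sum_{x\in S}|f(x)|^p,\qquad \|g\|_{L^r(\mathbb{F}_q^d,dm)}^r=\sum_{m\in\mathbb{F}_q^d}|g(m)|^r.$$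 $R^*(p\to r)$ is the smallest constant such that $\|\widehat{fd\sigma}\|_{L^r(\mathbb{F}_q^d,dm)}\le R^*(p\to r)\|f\|_{L^p(S,d\sigma)}$ for all functions $f$ on $S$, and $R^*(p\to r)\lesssim1$ means that it is bounded by a constant independent of $q$. The Tomas-Stein exponents are the pairs $(p,r)$ with $r\ge\frac{2d+2}{d-1}$ and $r\ge\frac{p(d+1)}{(p-1)(d-1)}$. *)

(* Defs.v *)
From HB Require Import structures.
From mathcomp Require Import all_boot all_order all_algebra.
From mathcomp Require Import reals exp.
From mathcomp Require Import complex.

Set Implicit Arguments.
Unset Strict Implicit.
Unset Printing Implicit Defensive.

Import Order.TTheory GRing.Theory Num.Theory.

Local Open Scope ring_scope.
Local Open Scope complex_scope.

Definition odd_prime_power (q : nat) : Prop :=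
  exists l k : nat, [/\ prime l, odd l, (0 < k)%N & q = (l ^ k)%N].

Definition nontrivial_add_char (R : realType) (F : finFieldType)
    (chi : F -> R[i]) : Prop :=
  [/\ chi 0 = 1,
      forall a b : F, chi (a + b) = chi a * chi b
    & exists a : F, chi a <> 1].

(* No square root is taken: this is the F-valued quadratic form. *)
Definition sqnorm (F : finFieldType) (d : nat) (x : 'rV[F]_d) : F :=
  \sum_(i < d) x 0 i ^+ 2.

Definition dotprod (F : finFieldType) (d : nat) (x m : 'rV[F]_d) : F :=
  \sum_(i < d) x 0 i * m 0 i.

Definition sphere (F : finFieldType) (d : nat) (j : F) : {set 'rV[F]_d} :=
  [set x | sqnorm x == j].

Definition sphere_pt (F : finFieldType) (d : nat) (j : F) : finType :=
  {x : 'rV[F]_d | x \in sphere d j}.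

(* The Fourier transform of f d(sigma), d(sigma) being the normalized surface
   measure (mass #|S|^-1 at each point of the sphere S). *)
Definition ext (R : realType) (F : finFieldType) (chi : F -> R[i]) (d : nat)
    (j : F) (f : sphere_pt d j -> R[i]) (m : 'rV[F]_d) : R[i] :=
  (#|sphere d j|%:R)^-1 *
    \sum_(x : sphere_pt d j) chi (- dotprod (val x) m) * f x.

Definition Lp_sphere (R : realType) (F : finFieldType) (d : nat) (j : F)
    (p : R) (f : sphere_pt d j -> R[i]) : R :=
  ((#|sphere d j|%:R)^-1 *
     \sum_(x : sphere_pt d j) Normc.normc (f x) `^ p) `^ p^-1.

(* Counting measure on the dual space, as opposed to Lp_sphere. *)
Definition Lr_dual (R : realType) (F : finFieldType) (d : nat) (r : R)
    (g : 'rV[F]_d -> R[i]) : R :=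
  (\sum_(m : 'rV[F]_d) Normc.normc (g m) `^ r) `^ r^-1.

(* C is an admissible constant in the L^p -> L^r extension inequality for the
   sphere of radius j, i.e. R^*(p -> r) <= C. *)
Definition extension_bound (R : realType) (F : finFieldType) (chi : F -> R[i])
    (d : nat) (j : F) (p r C : R) : Prop :=
  forall f : sphere_pt d j -> R[i],
    Lr_dual r (ext chi f) <= C * Lp_sphere p f.

(* Main.v *)
(** If i^2 = -1 and d = 2k + 1, the unit sphere contains the affine k-plane E of
    the points (t, i t, 1). On the orthogonal of its direction, a subspace of
    dimension k + 1, the phase of chi (- x . m) does not depend on x in E, so
    the transform of the indicator of E has modulus |E| / |S| there. As
    |S| <= 2 q^(2k), the extension inequality gives q^((k+1)/r - k (1 - 1/p))
    <= 2^(1 - 1/p) C. Letting q run through the powers of 5, where 2^2 = -1,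
    forces the exponent to be nonpositive. *)
Require Import Defs.
From HB Require Import structures.
From mathcomp Require Import all_boot all_order all_algebra.
From mathcomp Require Import reals exp.
From mathcomp Require Import finfield complex ring lra.

Set Implicit Arguments.
Unset Strict Implicit.
Unset Printing Implicit Defensive.

Import Order.TTheory GRing.Theory Num.Theory.

Local Open Scope ring_scope.
Local Open Scope complex_scope.

Lemma normc_nat (R : realType) (n : nat) : Normc.normc (n%:R : R[i]) = n%:R.
Proof. by rewrite (@normcMn R 1 n) Normc.normc1. Qed.

Lemma normcX (R : realType) (z : R[i]) (n : nat) :
  Normc.normc (z ^+ n) = Normc.normc z ^+ n.
Proof.
by elim: n => [|n IH]; rewrite ?expr0 ?Normc.normc1 // !exprS Normc.normcM IH.
Qed.

Lemma normc_ge0 (R : realType) (z : R[i]) : 0 <= Normc.normc z.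
Proof. by case: z => a b; apply: sqrtr_ge0. Qed.

(** In characteristic [l] every [a] satisfies [a *+ l = 0], so [chi a] is an [l]-th root of
    unity. *)
Lemma normc_add_char (R : realType) (F : finFieldType) (chi : F -> R[i])
    (hchi : nontrivial_add_char chi) (a : F) : Normc.normc (chi a) = 1.
Proof.
case: hchi => chi0 chiD _.
have chiMn n : chi (a *+ n) = chi a ^+ n.
  by elim: n => [|n IH]; rewrite ?mulr0n ?expr0 // mulrS exprS chiD IH.
case: (finPcharP F) => l l_pr lF.
have := congr1 (@Normc.normc R) (chiMn l).
rewrite mulrn_pchar // chi0 Normc.normc1 normcX => /esym/eqP.
by rewrite pexpr_eq1 ?normc_ge0 ?prime_gt0 // => /eqP.
Qed.

(** Test the inequality on the indicator of [E]. For [m] in [M] all terms carry the same phase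
    [chi (- c m)], so nothing cancels and the transform has modulus [e = #|E| / #|S|], while the
    norm on the sphere is [e] to the power [1/p]. *)
Lemma extension_bound_indicator (R : realType) (F : finFieldType)
    (chi : F -> R[i]) (hchi : nontrivial_add_char chi) (d : nat) (j : F)
    (p r C : R) (p_gt0 : 0 < p) (r_gt0 : 0 < r)
    (E : {set sphere_pt d j}) (M : {set 'rV[F]_d}) (c : 'rV[F]_d -> F)
    (EM : {in E & M, forall x m, dotprod (val x) m = c m})
    (E_gt0 : (0 < #|E|)%N) :
  extension_bound chi d j p r C ->
  (#|E|%:R / #|sphere d j|%:R) `^ (1 - p^-1) * #|M|%:R `^ r^-1 <= C.
Proof.
move=> /(_ (fun x => (x \in E)%:R)).
set s := #|sphere d j|%:R : R; set f := fun x => _.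
have sE : (0 < #|sphere d j|)%N.
  case/card_gt0P: E_gt0 => x _; apply/card_gt0P; exists (val x).
  exact: valP x.
have s_gt0 : 0 < s by rewrite ltr0n.
set e := #|E|%:R / s.
have e_gt0 : 0 < e by rewrite divr_gt0 // ltr0n.
have -> : Lp_sphere p f = e `^ p^-1.
  rewrite /Lp_sphere -/s mulrC; congr ((_ / _) `^ _).
  rewrite -sum1_card natr_sum [RHS]big_mkcond; apply: eq_bigr => x _.
  by rewrite normc_nat; case: (x \in E); rewrite ?powR1 ?powR0 ?gt_eqF.
have ext_M m : m \in M -> Normc.normc (ext chi f m) = e.
  move=> mM; rewrite /ext Normc.normcM Normc.normcV normc_nat -/s mulrC.
  congr (_ / _).
  have -> : \sum_(x : sphere_pt d j) chi (- dotprod (val x) m) * f x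
      = chi (- c m) * #|E|%:R.
    rewrite -sum1_card natr_sum mulr_sumr [RHS]big_mkcond.
    apply: eq_bigr => x _; rewrite /f.
    by case: ifP => [xE|_]; rewrite ?mulr0 // EM.
  by rewrite Normc.normcM normc_add_char // mul1r normc_nat.
(* Discarding the frequencies outside [M] only lowers the norm. *)
have leM : #|M|%:R `^ r^-1 * e <= Lr_dual r (ext chi f).
  have -> : #|M|%:R `^ r^-1 * e = (#|M|%:R * e `^ r) `^ r^-1.
    by rewrite powRM ?ler0n ?powR_ge0 // -powRrM mulfV ?gt_eqF ?powRr1 // ltW.
  apply: ge0_ler_powR; rewrite ?nnegrE ?invr_ge0 ?(ltW r_gt0) //.
  - by rewrite mulr_ge0 ?powR_ge0 ?ler0n.
  - by apply: sumr_ge0 => m _; apply: powR_ge0.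
  rewrite (bigID (mem M)) /= -[leLHS]addr0 lerD //.
    rewrite mulr_natl -sumr_const; apply: ler_sum => m mM.
    by rewrite ext_M.
  by apply: sumr_ge0 => m _; apply: powR_ge0.
move=> /(le_trans leM); rewrite -ler_pdivrMr ?powR_gt0 // => leC.
apply: le_trans leC; rewrite powRB ?(gt_eqF e_gt0) ?implybT // powRr1 ?(ltW e_gt0) //.
by rewrite mulrC mulrA.
Qed.

Lemma card_sphere_le (F : finFieldType) (n : nat) (j : F) :
  (#|sphere (n + 1) j| <= #|F| ^ n * 2)%N.
Proof.
(* A point is determined by its first n coordinates and by whether its last
   coordinate is the chosen square root or its opposite. *)
pose root (y : 'rV[F]_n) := odflt 0 [pick c : F | c ^+ 2 == j - sqnorm y].
pose h (x : 'rV[F]_(n + 1)) := (lsubmx x, rsubmx x 0 0 == root (lsubmx x)).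
have sqnorm_split (x : 'rV[F]_(n + 1)) :
    sqnorm x = sqnorm (lsubmx x) + rsubmx x 0 0 ^+ 2.
  rewrite /sqnorm big_split_ord big_ord1 /= mxE; congr (_ + _).
  by apply: eq_bigr => l _; rewrite mxE.
(* On the sphere the last coordinate itself witnesses that [pick] succeeds, so the default 0 of
   [root] is harmless. *)
have last_sq x : x \in sphere (n + 1) j ->
    rsubmx x 0 0 ^+ 2 = root (lsubmx x) ^+ 2.
  rewrite inE sqnorm_split => /eqP xj.
  have xj' : rsubmx x 0 0 ^+ 2 = j - sqnorm (lsubmx x).
    by rewrite -xj addrAC subrr add0r.
  rewrite xj' /root; case: pickP => [c /eqP //|/(_ (rsubmx x 0 0))].
  by rewrite xj' eqxx.
have h_inj : {in sphere (n + 1) j &, injective h}.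
  move=> x y xS yS [xy].
  have := last_sq y yS; have := last_sq x xS; rewrite -xy.
  move=> /eqP; rewrite eqf_sqr => xr /eqP; rewrite eqf_sqr => yr exy.
  rewrite -[x]hsubmxK -[y]hsubmxK xy; congr row_mx.
  apply/rowP => l; rewrite !ord1; move: exy xr yr.
  (* Equal flags: both last coordinates are the chosen root, or both are its opposite. *)
  case: eqP => [->|_]; case: eqP => [->|_] //= _.
  by move=> /eqP-> /eqP->.
rewrite -(card_in_imset h_inj); apply: leq_trans (max_card _) _.
by rewrite card_prod card_mx card_bool mul1n.
Qed.

Section IsotropicSubspace.

Variables (F : finFieldType) (i : F) (i2 : i ^+ 2 = -1) (k : nat).

Definition flat_pt (t : 'rV[F]_k) : 'rV[F]_(k + k + 1) :=
  row_mx (row_mx t (i *: t)) (const_mx 1).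

(** The orthogonal of the directions [(t, i t, 0)] consists of the [(a, b, c)] with [a + i b = 0];
    here [b] and [c] are the free parameters. *)
Definition flat_dual (uc : 'rV[F]_k * F) : 'rV[F]_(k + k + 1) :=
  row_mx (row_mx (- i *: uc.1) uc.1) (const_mx uc.2).

Lemma flat_pt_sphere t : flat_pt t \in sphere (k + k + 1) 1.
Proof.
rewrite inE /sqnorm !big_split_ord big_ord1 /= row_mxEr mxE expr1n.
rewrite -big_split big1 /= ?add0r // => l _.
by rewrite !row_mxEl row_mxEr mxE exprMn i2 mulN1r subrr.
Qed.

Lemma flat_pt_inj : injective flat_pt.
Proof. by move=> t u /eq_row_mx[/eq_row_mx[]]. Qed.

Lemma flat_dual_inj : injective flat_dual.
Proof.
move=> [u a] [v b] /eq_row_mx[/eq_row_mx[_ /= ->]] /matrixP/(_ 0 0).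
by rewrite !mxE => ->.
Qed.

Lemma dotprod_flat t uc : dotprod (flat_pt t) (flat_dual uc) = uc.2.
Proof.
rewrite /dotprod !big_split_ord big_ord1 /= !row_mxEr !mxE mul1r.
rewrite -big_split big1 /= ?add0r // => l _.
rewrite !row_mxEl !row_mxEr !mxE.
by rewrite mulrCA !mulNr mulrA addNr.
Qed.

Lemma extension_bound_flat (R : realType) (chi : F -> R[i])
    (hchi : nontrivial_add_char chi) (p r C : R)
    (p_gt1 : 1 < p) (r_gt0 : 0 < r) :
  extension_bound chi (k + k + 1) 1 p r C ->
  (2 * #|F|%:R ^+ k)^-1 `^ (1 - p^-1) * (#|F|%:R ^+ k.+1) `^ r^-1 <= C.
Proof.
have p_gt0 : 0 < p by apply: lt_trans p_gt1.
pose pt t : sphere_pt (k + k + 1) (1 : F) := Sub (flat_pt t) (flat_pt_sphere t).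
pose E := [set pt t | t in setT]; pose M := [set flat_dual uc | uc in setT].
have cardE : #|E| = (#|F| ^ k)%N.
  rewrite card_imset ?cardsT ?card_mx ?mul1n // => t u /(congr1 val).
  exact: flat_pt_inj.
have cardM : #|M| = (#|F| ^ k.+1)%N.
  rewrite card_imset ?cardsT ?card_prod ?card_mx ?mul1n ?expnSr //.
  exact: flat_dual_inj.
have q_gt0 : (0 < #|F|)%N by apply/card_gt0P; exists 0.
have E_gt0 : (0 < #|E|)%N by rewrite cardE expn_gt0 q_gt0.
have EM : {in E & M, forall x m, dotprod (val x) m = m 0 (rshift (k + k) 0)}.
  move=> x m /imsetP[t _ ->] /imsetP[uc _ ->].
  by rewrite dotprod_flat row_mxEr mxE.
move=> /(extension_bound_indicator hchi p_gt0 r_gt0 EM E_gt0).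
rewrite cardM natrX; apply: le_trans; rewrite ler_wpM2r ?powR_ge0 //.
have s_gt0 : (0 < #|sphere (k + k + 1) (1%R : F)|)%N.
  by apply/card_gt0P; exists (flat_pt 0); apply: flat_pt_sphere.
(* As [p > 1], the exponent [1 - 1/p] is nonnegative, so it suffices that [#|E| / #|S|] is at least
   [q^k / (2 q^(2k))]. *)
apply: ge0_ler_powR; rewrite ?nnegrE ?subr_ge0 ?invf_le1 ?(ltW p_gt1) //.
- by rewrite invr_ge0 mulr_ge0 // exprn_ge0.
- by rewrite divr_ge0.
rewrite ler_pdivlMr ?ltr0n // mulrC ler_pdivrMr; last first.
  by rewrite mulr_gt0 // exprn_gt0 // ltr0n.
rewrite cardE -natrX -!natrM ler_nat (leq_trans (card_sphere_le _ _)) //.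
by rewrite expnD mulnCA mulnC.
Qed.

End IsotropicSubspace.

Lemma pchar5_sqrtN1 (F : fieldType) : 5%N \in [pchar F] -> (2 : F) ^+ 2 = -1.
Proof.
move=> /pcharf0 F5; apply/eqP; rewrite -subr_eq0 opprK -natrX natr1.
exact/eqP.
Qed.

(** If [e > 0], then [exp x >= 1 + x] at [x = (n+1) e ln a] makes the powers unbounded. The exponent
    starts at 1 because [5 ^ 0] is not the order of a field. *)
Lemma bounded_powR_natX (R : realType) (a e K : R) :
  1 < a -> (forall n : nat, (a ^+ n.+1) `^ e <= K) -> e <= 0.
Proof.
move=> a_gt1 bd; rewrite leNgt; apply/negP => e_gt0.
have a_gt0 : 0 < a by apply: lt_trans a_gt1.
have c_gt0 : 0 < e * ln a by rewrite mulr_gt0 ?ln_gt0.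
pose n := Num.truncn (K / (e * ln a)).
have := bd n; rewrite leNgt => /negP; apply.
have lt1 : K < n.+1%:R * (e * ln a) by rewrite -ltr_pdivrMr // truncnS_gt.
rewrite /powR gt_eqF ?exprn_gt0 // lnXn // -mulr_natl mulrCA.
by apply: (lt_le_trans lt1); apply: le_trans (expR_ge1Dx _); rewrite lerDr.
Qed.

Theorem mainTheorem3 (R : realType)
    (Fq : nat -> finFieldType)
    (cardFq : forall q : nat, odd_prime_power q -> #|Fq q| = q)
    (chi : forall q : nat, Fq q -> R[i])
    (chi_char : forall q : nat, odd_prime_power q ->
       nontrivial_add_char (chi q))
    (d : nat) (d_ge3 : (3 <= d)%N) (d_odd : odd d)
    (p r : R) (p_gt1 : 1 < p)
    (r_ge : (2 * d%:R + 2) / (d%:R - 1) <= r)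
    (bounded : exists C : R, forall q : nat, odd_prime_power q ->
       (exists i : Fq q, i ^+ 2 = -1) ->
       forall j : Fq q, j != 0 -> extension_bound (chi q) d j p r C) :
  p * (d%:R + 1) / ((p - 1) * (d%:R - 1)) <= r.
Proof.
have d_gt1 : 0 < d%:R - 1 :> R by rewrite subr_gt0 ltr1n (leq_trans _ d_ge3).
have r_gt0 : 0 < r.
  by apply: lt_le_trans r_ge; rewrite divr_gt0 // addr_gt0 // mulr_gt0 ?ltr0n //
    (leq_trans _ d_ge3).
have p_gt0 : 0 < p by apply: lt_trans p_gt1.
have [C bd] := bounded.
pose k := d./2.
have dE : d = (k + k + 1)%N by rewrite addnn addn1 -[LHS]odd_double_half d_odd.
pose c := 1 - p^-1.
have le_e : k.+1%:R * r^-1 - k%:R * c <= 0.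
  (* The factor 2 to the power [c] comes from the 2 in the bound on the size of the sphere. *)
  apply: (@bounded_powR_natX R 5 _ (C * 2 `^ c)); first by rewrite ltr1n.
  move=> n; pose q := (5 ^ n.+1)%N.
  have qpp : odd_prime_power q by exists 5%N, n.+1.
  have F5 := card_finPcharP (cardFq q qpp) (isT : prime 5).
  have := bd q qpp (ex_intro _ 2 (pchar5_sqrtN1 F5)) 1 (oner_neq0 _).
  rewrite dE => /(extension_bound_flat (pchar5_sqrtN1 F5) (chi_char q qpp) p_gt1 r_gt0).
  rewrite (cardFq q qpp) /q natrX; set Q := 5 ^+ n.+1.
  have Q_gt0 : 0 < Q :> R by rewrite exprn_gt0 // ltr0n.
  have Q_ge0 := ltW Q_gt0.
  have D_ge0 : 0 <= 2 * Q ^+ k :> R by rewrite mulr_ge0 // exprn_ge0.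
  (* Separate the powers of 2 from those of [Q], then collect the latter into the single exponent
     [(k+1)/r - k c]. *)
  rewrite -/c -powR_inv1 // -powRrM mulN1r powRN.
  rewrite powRM ?exprn_ge0 // -!powR_mulrn // -!powRrM mulrC.
  rewrite ler_pdivrMr ?mulr_gt0 ?powR_gt0 // mulrA -ler_pdivrMr ?powR_gt0 //.
  by rewrite [Q `^ (_ - _)]powRB ?(gt_eqF Q_gt0) ?implybT.
have kE : d%:R = 2 * k%:R + 1 :> R by rewrite dE !natrD; ring.
have k_gt0 : 0 < k%:R :> R by move: d_gt1; rewrite kE; lra.
have p1_gt0 : 0 < p - 1 by rewrite subr_gt0.
move: le_e; rewrite subr_le0 ler_pdivrMr // -natr1 => le_e.
rewrite ler_pdivrMr ?mulr_gt0 // kE.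
have pc : p * c = p - 1 by rewrite mulrBr mulr1 mulfV ?gt_eqF.
rewrite -pc -subr_ge0.
(* With denominators cleared and [d = 2k + 1], the required gap is [2 p] times the gap in
   [k + 1 <= k c r]. *)
have -> : r * (p * c * (2 * k%:R + 1 - 1)) - p * (2 * k%:R + 1 + 1)
  = 2 * p * (k%:R * c * r - (k%:R + 1)) by ring.
by rewrite mulr_ge0 ?subr_ge0 // mulr_ge0 // ltW.
Qed.
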